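(* For every integer $d\ge 2$ there exists a constant $c_d>0$ depending only on $d$ such that the following holds. Let $\varepsilon\in(0,1)$ and $n_1,\ldots,n_d\in\mathbb{N}$, and set $$r=\left\lceil \frac{c_d}{\varepsilon^2}\log\Big(2e\prod_{s=1}^{d} n_s\Big)\right\rceil\in\mathbb{N},$$ where $e$ is Euler's number. Then for every tensor $\mathcal{A}\in\mathbb{R}^{n_1\times\cdots\times n_d}$ there exists a tensor $\mathcal{B}\in\mathbb{R}^{n_1\times\cdots\times n_d}$ all components of whose TT rank are at most $r$ such that $$\|\mathcal{A}-\mathcal{B}\|_{\max}\le \varepsilon\cdot\gamma_{\mathrm F}^{\mathrm{TT}}(\mathcal{A}).$$
   Context: $\mathbb{N}$ denotes the positive integers, $[n]=\{1,\ldots,n\}$, and $\|\mathcal{A}\|_{\max}=\max_{i_1,\ldots,i_d}|\mathcal{A}(i_1,\ldots,i_d)|$. Tensor-train (TT) factorization: a tensor $\mathcal{A}\in\mathbb{R}^{n_1\times\cdots\times n_d}$ is represented in the TT format with TT cores $\mathcal{G}_s\in\mathbb{R}^{r_{s-1}\times n_s\times r_s}$, $s\in[d]$, with $r_0=r_d=1$ and $r_1,\ldots,r_{d-1}\in\mathbb{N}$ arbitrary, if for all indices $$\mathcal{A}(i_1,\ldots,i_d)=\sum_{\alpha_1=1}^{r_1}\cdots\sum_{\alpha_{d-1}=1}^{r_{d-1}}\mathcal{G}_1(1,i_1,\alpha_1)\mathcal{G}_2(\alpha_1,i_2,\alpha_2)\cdots\mathcal{G}_d(\alpha_{d-1},i_d,1).$$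 In short, $\mathcal{A}=\mathrm{TT}(\mathcal{G}_1,\ldots,\mathcal{G}_d)$. The tuple $(r_1,\ldots,r_{d-1})$ is the TT rank of the factorization. The componentwise smallest TT rank among all exact TT factorizations of $\mathcal{A}$ is called the TT rank of $\mathcal{A}$. For a third-order tensor $\mathcal{G}\in\mathbb{R}^{p\times n\times q}$ let $\|\mathcal{G}\|_{\mathrm F,\infty}=\max_{i\in[n]}\|\mathcal{G}(:,i,:)\|_{\mathrm F}$, where $\mathcal{G}(:,i,:)\in\mathbb{R}^{p\times q}$ is the $i$th slice and $\|\cdot\|_{\mathrm F}$ is the Frobenius norm of matrices. The TT factorization quasinorm is $$\gamma_{\mathrm F}^{\mathrm{TT}}(\mathcal{A})=\inf\Big\{\prod_{s=1}^{d}\|\mathcal{G}_s\|_{\mathrm F,\infty}\;:\;\mathcal{A}=\mathrm{TT}(\mathcal{G}_1,\ldots,\mathcal{G}_d)\Big\},$$ the infimum being over all TT factorizations of $\mathcal{A}$ (of arbitrary TT rank). *)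

(* Defs.v *)
From HB Require Import structures.
From mathcomp Require Import all_boot all_order all_algebra.
From mathcomp Require Import classical_sets reals sequences exp.

Set Implicit Arguments.
Unset Strict Implicit.
Unset Printing Implicit Defensive.

Import Order.TTheory GRing.Theory Num.Theory.

Local Open Scope ring_scope.
Local Open Scope classical_set_scope.

(* Real tensors of format n_1 x ... x n_d, with 0-based modes and indices. *)
Definition multi_index (d : nat) (n : 'I_d -> nat) : finType :=
  {dffun forall s : 'I_d, 'I_(n s)}.

Definition tensor (R : realType) (d : nat) (n : 'I_d -> nat) : zmodType :=
  {ffun multi_index n -> R}.

(* The maxima below are taken over nonempty index sets in every use where the
   mode sizes are positive, and the entries are nonnegative, so the default
   value 0 does not interfere. *)
Definition max_norm (R : realType) (d : nat) (n : 'I_d -> nat)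
    (A : tensor R n) : R :=
  \big[Num.max/0]_(i : multi_index n) `|A i|.

Definition frobenius_norm (R : realType) (p q : nat) (M : 'M[R]_(p, q)) : R :=
  Num.sqrt (\sum_(a < p) \sum_(b < q) M a b ^+ 2).

Definition tensor3 (R : realType) (p n q : nat) : Type :=
  'I_p -> 'I_n -> 'I_q -> R.

Definition slice (R : realType) (p n q : nat) (G : tensor3 R p n q)
    (i : 'I_n) : 'M[R]_(p, q) := \matrix_(a < p, b < q) G a i b.

Definition norm_Finf (R : realType) (p n q : nat) (G : tensor3 R p n q) : R :=
  \big[Num.max/0]_(i < n) frobenius_norm (slice G i).

(* The s-th core (0-based s) sits between the bonds s and s + 1. *)
Definition lbond (d : nat) (s : 'I_d) : 'I_d.+1 := widen_ord (leqnSn d) s.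
Definition rbond (d : nat) (s : 'I_d) : 'I_d.+1 := lift ord0 s.

(* [tt_rk] is the tuple (r_0, r_1, ..., r_d). *)
Record tt_cores (R : realType) (d : nat) (n : 'I_d -> nat) : Type := TTCores {
  tt_rk : 'I_d.+1 -> nat;
  tt_rk_gt0 : forall k : 'I_d.+1, (0 < tt_rk k)%N;
  tt_rk_first : tt_rk ord0 = 1%N;
  tt_rk_last : tt_rk ord_max = 1%N;
  tt_core : forall s : 'I_d, tensor3 R (tt_rk (lbond s)) (n s) (tt_rk (rbond s))
}.

Arguments tt_core {R d n} G s _ _ _ : rename.

(* The sum also runs over alpha_0 and alpha_d, which take a single value
   because r_0 = r_d = 1. *)
Definition TT (R : realType) (d : nat) (n : 'I_d -> nat)
    (G : tt_cores R n) : tensor R n :=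
  [ffun i : multi_index n =>
     \sum_(alpha : {dffun forall k : 'I_d.+1, 'I_(tt_rk G k)})
       \prod_(s < d) tt_core G s (alpha (lbond s)) (i s) (alpha (rbond s))].

Definition is_tt_rank (R : realType) (d : nat) (n : 'I_d -> nat)
    (A : tensor R n) (rho : 'I_d.+1 -> nat) : Prop :=
  (exists2 G : tt_cores R n, TT G = A & tt_rk G =1 rho) /\
  (forall G : tt_cores R n, TT G = A ->
     forall k : 'I_d.+1, (rho k <= tt_rk G k)%N).

Definition gamma_TT (R : realType) (d : nat) (n : 'I_d -> nat)
    (A : tensor R n) : R :=
  inf [set x : R | exists2 G : tt_cores R n,
         TT G = A & x = \prod_(s < d) norm_Finf (tt_core G s)].

(* Main.v *)
Require Import Defs.
From HB Require Import structures.
From mathcomp Require Import all_boot all_order all_algebra.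
From mathcomp Require Import boolp classical_sets reals sequences exp.
From mathcomp Require Import zify ring lra.

Set Implicit Arguments.
Unset Strict Implicit.
Unset Printing Implicit Defensive.

Import Order.TTheory GRing.Theory Num.Theory.

Local Open Scope ring_scope.

(* Insert at every inner bond a factor Y Y^T close to the identity, where Y has r
   columns. Write A(I) = <u_I, v_I> for the partial products u_I, v_I on the two
   sides of a bond. A Johnson-Lindenstrauss argument provides Y such that
   <Y^T u_I, Y^T v_I> is within delta C of <u_I, v_I> for all indices I, and such
   that the squared Frobenius norms of the slices of the two adjacent cores at
   most double, so that the next bond can be treated in the same way. As
   4 prod n_s <= 2e prod n_s, the union bound over the four families of quadratic
   forms involved costs exactly the logarithm in the statement. The infimum in
   gamma need not be attained; a factorization within a factor 2 of it is enough.

   The componentwise smallest TT rank exists by the same insertion at one bond: if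
   A = L U = L' U' are the two unfoldings of A at a bond, with L' of h columns, and
   A P A = A, then (U P L') (U' P L) may be inserted between L and U without
   changing A, and replaces the bond dimension by h. *)

(** * Simultaneous projection of quadratic forms *)

(** Lagrange's identity: the sum of the squares [(u_i v_j - u_j v_i)^2] is twice the difference of
    the two sides. *)
Lemma sum_cauchy_schwarz (R : realType) (I : finType) (u v : I -> R) :
  (\sum_i u i * v i) ^+ 2 <= (\sum_i u i ^+ 2) * (\sum_i v i ^+ 2).
Proof.
have : 0 <= \sum_i \sum_j (u i * v j - u j * v i) ^+ 2.
  by apply: sumr_ge0 => i _; apply: sumr_ge0 => j _; exact: sqr_ge0.
have -> : \sum_i \sum_j (u i * v j - u j * v i) ^+ 2 =
    2 * ((\sum_i u i ^+ 2) * (\sum_i v i ^+ 2)) - 2 * (\sum_i u i * v i) ^+ 2.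
  have -> : \sum_i \sum_j (u i * v j - u j * v i) ^+ 2 =
    \sum_i \sum_j (u i ^+ 2 * v j ^+ 2) + \sum_i \sum_j (u j ^+ 2 * v i ^+ 2)
    - 2 * \sum_i \sum_j ((u i * v i) * (u j * v j)).
    rewrite mulr_sumr -big_split -sumrB; apply: eq_bigr => i _ /=.
    rewrite mulr_sumr -big_split -sumrB; apply: eq_bigr => j _ /=; ring.
  rewrite [X in _ + X - _]exchange_big -!big_distrlr /=; ring.
by lra.
Qed.

(* [cosh 2t <= (cosh t)^4] reduces to small [t], where
   [cosh t <= (1 / (1 - t) + 1 / (1 + t)) / 2]. *)
Lemma cosh_le_expR_sqr (R : realType) (t : R) :
  (expR t + expR (- t)) / 2 <= expR (2 * t ^+ 2).
Proof.
have small (s : R) : s ^+ 2 <= 1 / 2 ->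
    (expR s + expR (- s)) / 2 <= expR (2 * s ^+ 2).
  move=> hs.
  have s1 : 0 < 1 - s by nra.
  have s2 : 0 < 1 + s by nra.
  have h1 : expR s <= (1 - s)^-1.
    rewrite -[s]opprK expRN opprK lef_pV2 ?posrE ?expR_gt0 //.
    exact: expR_ge1Dx.
  have h2 : expR (- s) <= (1 + s)^-1.
    by rewrite expRN lef_pV2 ?posrE ?expR_gt0 // expR_ge1Dx.
  have h3 := expR_ge1Dx (2 * s ^+ 2).
  have : ((1 - s)^-1 + (1 + s)^-1) / 2 = (1 - s ^+ 2)^-1.
    by field; rewrite ?gt_eqF //; nra.
  have : (1 - s ^+ 2)^-1 <= 1 + 2 * s ^+ 2.
    rewrite -div1r ler_pdivrMr; last by nra.
    nra.
  by lra.
have [k] : exists k : nat, t ^+ 2 <= 1 / 2 * 4 ^+ k.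
  exists (Num.bound (2 * t ^+ 2)).
  have := archi_boundP (x := 2 * t ^+ 2); set b := Num.bound _.
  move=> /(_ ltac:(by rewrite mulr_ge0 // sqr_ge0)) hb.
  have : (b%:R : R) <= 4 ^+ b.
    rewrite -natrX ler_nat; apply: ltnW; exact: ltn_expl.
  by lra.
elim: k t => [|k IH] t; first by rewrite expr0 mulr1; exact: small.
rewrite [4 ^+ _]exprS => ht.
have := IH (t / 2).
have -> : (t / 2) ^+ 2 = t ^+ 2 / 4 by field.
move: ht; set y := 4 ^+ k => ht /(_ ltac:(by lra)).
have -> : t ^+ 2 / 4 = (t / 2) ^+ 2 by field.
set c := ((expR _ + _) / 2) => hc.
have e1 : expR t = expR (t / 2) ^+ 2 by rewrite -expRM_natl; congr expR; field.
have e2 : expR (- t) = expR (- (t / 2)) ^+ 2.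
  by rewrite -expRM_natl; congr expR; field.
have e3 : expR (t / 2) * expR (- (t / 2)) = 1 by rewrite -expRD subrr expR0.
have -> : (expR t + expR (- t)) / 2 = 2 * c ^+ 2 - 1.
  rewrite [X in _ = _ - X](_ : 1 = expR (t / 2) * expR (- (t / 2))) //.
  by rewrite e1 e2 /c; field.
have -> : expR (2 * t ^+ 2) = expR (2 * (t / 2) ^+ 2) ^+ 4.
  by rewrite -expRM_natl; congr expR; field.
have c0 : 0 <= c by rewrite /c divr_ge0 ?addr_ge0 ?expR_ge0.
have h4 : c ^+ 4 <= expR (2 * (t / 2) ^+ 2) ^+ 4 by rewrite lerXn2r ?nnegrE // expR_ge0.
apply: le_trans h4.
(* With [c = cosh (t / 2)], this is [2 c^2 - 1 <= c^4], whose left side is [cosh t]. *)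
have := sqr_ge0 (c ^+ 2 - 1).
by rewrite sqrrB1 -exprM; lra.
Qed.

(* A derandomized exponential moment bound for Rademacher chaos of order two.
   Averaging over the first sign turns [exp (2 e b.x)] into
   [cosh (2 b.x) <= exp (8 (b.x)^2)], which is absorbed in the form of the other
   variables as [Q' = q + 8 b b^T]. The Frobenius norm does not grow since
   [|Q'|^2 <= |q|^2 + |b|^2], while [|Q|^2 >= |q|^2 + 2 |b|^2]. *)
Lemma sign_vector (R : realType) (T : finType) (p : nat) (w : T -> R)
    (Q : T -> 'I_p -> 'I_p -> R) :
  (forall t, 0 <= w t) ->
  (forall t i j, Q t i j = Q t j i) ->
  (forall t, \sum_i \sum_j Q t i j ^+ 2 <= 1 / 400) ->
  exists x : 'I_p -> R,
    \sum_t w t * expR (\sum_i \sum_j Q t i j * (x i * x j) - \sum_i Q t i i)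
    <= \sum_t w t * expR (8 * \sum_i \sum_j Q t i j ^+ 2).
Proof.
elim: p w Q => [|p IH] w Q w0 Qsym Qle.
  by exists (fun=> 0); apply: ler_sum => t _; rewrite !big_ord0 subr0 mulr0.
pose b t i := Q t ord0 (lift ord0 i).
pose q t i j := Q t (lift ord0 i) (lift ord0 j).
pose beta t := \sum_i b t i ^+ 2.
pose Q' t i j := q t i j + 8 * (b t i * b t j).
have beta0 t : 0 <= beta t by apply: sumr_ge0 => i _; exact: sqr_ge0.
have q0 t : 0 <= \sum_i \sum_j q t i j ^+ 2.
  by apply: sumr_ge0 => i _; apply: sumr_ge0 => j _; exact: sqr_ge0.
have normQ t : \sum_i \sum_j Q t i j ^+ 2 =
    Q t ord0 ord0 ^+ 2 + 2 * beta t + \sum_i \sum_j q t i j ^+ 2.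
  rewrite big_ord_recl big_ord_recl.
  under [X in _ + X]eq_bigr => i _ do rewrite big_ord_recl (Qsym t _ ord0).
  rewrite big_split /= -/(beta t) /q; ring.
have cross t : (\sum_i \sum_j q t i j * (b t i * b t j)) ^+ 2 <=
    (\sum_i \sum_j q t i j ^+ 2) * beta t ^+ 2.
  rewrite !pair_big /=; apply: le_trans (sum_cauchy_schwarz _ _) _.
  rewrite le_eqVlt; apply/orP; left; apply/eqP; congr (_ * _).
  rewrite [RHS]expr2 /beta big_distrlr pair_big.
  by apply: eq_bigr => ij _; rewrite exprMn.
have normQ' t : \sum_i \sum_j Q' t i j ^+ 2 <=
    (\sum_i \sum_j q t i j ^+ 2) + beta t.
  have -> : \sum_i \sum_j Q' t i j ^+ 2 = (\sum_i \sum_j q t i j ^+ 2)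
      + 16 * (\sum_i \sum_j q t i j * (b t i * b t j)) + 64 * beta t ^+ 2.
    rewrite [beta t ^+ 2]expr2 {1}/beta /beta big_distrlr !mulr_sumr.
    rewrite -!big_split; apply: eq_bigr => i _.
    rewrite !mulr_sumr -!big_split; apply: eq_bigr => j _ /=.
    rewrite /Q'; ring.
  have := cross t; have := Qle t; rewrite normQ.
  move: (q0 t) (beta0 t) (sqr_ge0 (Q t ord0 ord0)).
  set S := \sum_i \sum_j q t i j ^+ 2; set z := \sum_i _; set B := beta t.
  move=> S0 B0 a0 h1 h2.
  (* The constant [1 / 400] enters here: [S <= 1/400] gives [|z| <= B/20], and with [2 B <= 1/400]
     this yields [16 z + 64 B^2 <= B]. *)
  have : z ^+ 2 <= (B / 20) ^+ 2 by nra.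
  rewrite -real_normK ?num_real // ler_sqr ?nnegrE ?divr_ge0 // ler_norml => /andP[h3 h5].
  by nra.
have [x hx] := IH (fun t => w t * expR (8 * beta t)) Q'
  (fun t => mulr_ge0 (w0 t) (expR_ge0 _))
  ltac:(by move=> t i j; rewrite /Q' /q Qsym; ring)
  ltac:(by move=> t; apply: le_trans (normQ' t) _; have := Qle t; rewrite normQ;
          have := beta0 t; have := sqr_ge0 (Q t ord0 ord0); lra).
pose X (e : R) i := if unlift ord0 i is Some j then x j else e.
pose S t := \sum_i \sum_j q t i j * (x i * x j) - \sum_i q t i i.
pose l t := \sum_i b t i * x i.
(* As [e^2 = 1], the diagonal entry at [ord0] cancels against the trace, and the form becomes affine
   in the sign [e]. *)
have XE e t : e ^+ 2 = 1 ->
    \sum_i \sum_j Q t i j * (X e i * X e j) - \sum_i Q t i i =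
    S t + 2 * e * l t.
  move=> e1; rewrite !big_ord_recl.
  under [X in _ + X - _]eq_bigr => i _ do rewrite big_ord_recl (Qsym t _ ord0).
  have X0 : X e ord0 = e by rewrite /X unlift_none.
  have XS i : X e (lift ord0 i) = x i by rewrite /X liftK.
  rewrite X0 -expr2 e1 mulr1 /S /l big_split /=.
  under eq_bigr => i _ do rewrite XS.
  under [X in _ + (X + _) - _]eq_bigr => i _ do rewrite XS.
  under [X in _ + (_ + X) - _]eq_bigr => i _.
    under eq_bigr => j _ do rewrite !XS.
    over.
  have -> : \sum_i Q t ord0 (lift ord0 i) * (e * x i) = e * \sum_i b t i * x i.
    by rewrite mulr_sumr; apply: eq_bigr => i _; rewrite /b; ring.
  have -> : \sum_i Q t ord0 (lift ord0 i) * (x i * e) = e * \sum_i b t i * x i.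
    by rewrite mulr_sumr; apply: eq_bigr => i _; rewrite /b; ring.
  rewrite /q; ring.
pose f e := \sum_t w t * expR (\sum_i \sum_j Q t i j * (X e i * X e j) - \sum_i Q t i i).
have avg : (f 1 + f (-1)) / 2 <=
    \sum_t w t * expR (8 * \sum_i \sum_j Q t i j ^+ 2).
  apply: le_trans (_ : _ <= \sum_t (w t * expR (8 * beta t)) *
    expR (\sum_i \sum_j Q' t i j * (x i * x j) - \sum_i Q' t i i)) _.
    rewrite /f -big_split mulr_suml; apply: ler_sum => t _ /=.
    rewrite !XE ?sqrrN ?expr1n // -mulrDr -[leLHS]mulrA -[leRHS]mulrA ler_wpM2l //.
    rewrite -[leRHS]expRD.
    have -> : 8 * beta t + (\sum_i \sum_j Q' t i j * (x i * x j) - \sum_i Q' t i i)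
        = S t + 2 * (2 * l t) ^+ 2.
      have -> : \sum_i \sum_j Q' t i j * (x i * x j) =
          \sum_i \sum_j q t i j * (x i * x j) + 8 * l t ^+ 2.
        rewrite expr2 /l big_distrlr mulr_sumr -big_split; apply: eq_bigr => i _.
        rewrite mulr_sumr -big_split; apply: eq_bigr => j _ /=; rewrite /Q'; ring.
      have -> : \sum_i Q' t i i = \sum_i q t i i + 8 * beta t.
        rewrite /beta mulr_sumr -big_split; apply: eq_bigr => i _ /=.
        rewrite /Q'; ring.
      rewrite /S; ring.
    rewrite !(expRD (S t)) -mulrDr -[leLHS]mulrA ler_wpM2l ?expR_ge0 //.
    apply: le_trans (cosh_le_expR_sqr _).
    by rewrite -[2 * -1 * _]mulrA mulN1r mulrN mulr1.
  apply: le_trans hx _; apply: ler_sum => t _.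
  rewrite -mulrA ler_wpM2l // -expRD ler_expR.
  have := normQ' t; rewrite normQ; have := sqr_ge0 (Q t ord0 ord0); lra.
(* One of the two signs does at least as well as their average. *)
have [h|h] := leP (f 1) (f (-1)).
  by exists (X 1); rewrite -/(f 1); lra.
by exists (X (-1)); rewrite -/(f (-1)); lra.
Qed.

Lemma sign_vectors (R : realType) (T : finType) (p r : nat) (w : T -> R)
    (Q : T -> 'I_p -> 'I_p -> R) :
  (forall t, 0 <= w t) ->
  (forall t i j, Q t i j = Q t j i) ->
  (forall t, \sum_i \sum_j Q t i j ^+ 2 <= 1 / 400) ->
  exists X : 'I_r -> 'I_p -> R,
    \sum_t w t * expR (\sum_k
      (\sum_i \sum_j Q t i j * (X k i * X k j) - \sum_i Q t i i))
    <= \sum_t w t * expR (8 * \sum_i \sum_j Q t i j ^+ 2) ^+ r.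
Proof.
move=> + Qsym Qle; elim: r w => [|r IH] w w0.
  by exists (fun _ _ => 0); apply: ler_sum => t _; rewrite big_ord0 expR0 expr0.
have [x hx] := @sign_vector R T p
  (fun t => w t * expR (8 * \sum_i \sum_j Q t i j ^+ 2) ^+ r) Q
  (fun t => mulr_ge0 (w0 t) (exprn_ge0 _ (expR_ge0 _))) Qsym Qle.
have [X hX] := IH
  (fun t => w t * expR (\sum_i \sum_j Q t i j * (x i * x j) - \sum_i Q t i i))
  (fun t => mulr_ge0 (w0 t) (expR_ge0 _)).
exists (fun k => if unlift ord0 k is Some k' then X k' else x).
apply: le_trans (le_trans hX _).
  apply: ler_sum => t _; rewrite big_ord_recl unlift_none /= expRD mulrA.
  rewrite ler_wpM2l ?mulr_ge0 ?expR_ge0 // ler_expR.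
  by apply: ler_sum => k _; rewrite liftK.
rewrite [leRHS](_ : _ = \sum_t w t * expR (8 * \sum_i \sum_j Q t i j ^+ 2) ^+ r
   * expR (8 * \sum_i \sum_j Q t i j ^+ 2)).
  by apply: le_trans hx; apply: ler_sum => t _; rewrite mulrAC.
by apply: eq_bigr => t _; rewrite exprSr mulrA.
Qed.

(** Chernoff bound: [Y] consists of [r] sign vectors divided by [sqrt r]. Their total exponential
    moment is at most [|T| exp (8 l^2 r)], and it dominates the term of each single [t], as all
    terms are nonnegative. *)
Lemma projection_preserving_forms (R : realType) (T : finType) (p r : nat) (delta : R)
    (Q : T -> 'I_p -> 'I_p -> R) :
  0 < delta -> delta <= 1 -> (0 < r)%N -> 40 * ln (#|T|%:R : R) <= delta ^+ 2 * r%:R ->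
  (forall t i j, Q t i j = Q t j i) ->
  (forall t, \sum_i \sum_j Q t i j ^+ 2 <= 1) ->
  exists Y : 'I_p -> 'I_r -> R, forall t,
    \sum_k \sum_i \sum_j Q t i j * (Y i k * Y j k) <= \sum_i Q t i i + delta.
Proof.
move=> d0 d1 r0 hr Qsym Qle.
(* As [delta <= 1], this scale makes the forms [l Q] meet the bound [1 / 400]. *)
pose l := delta / 20.
have l0 : 0 < l by rewrite /l divr_gt0.
have rR : 0 < r%:R :> R by rewrite ltr0n.
pose P t i j := l * Q t i j.
have normP t : \sum_i \sum_j P t i j ^+ 2 <= l ^+ 2.
  rewrite -[leRHS]mulr1; apply: le_trans (ler_wpM2l (sqr_ge0 l) (Qle t)).
  rewrite le_eqVlt mulr_sumr; apply/orP; left; apply/eqP.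
  apply: eq_bigr => i _; rewrite mulr_sumr; apply: eq_bigr => j _.
  by rewrite exprMn.
have l2 : l ^+ 2 <= 1 / 400 by rewrite /l; nra.
have [X hX] := @sign_vectors R T p r (fun=> 1) P (fun=> ler01)
  ltac:(by move=> t i j; rewrite /P Qsym) (fun t => le_trans (normP t) l2).
pose s := Num.sqrt (r%:R : R).
have s2 : s ^+ 2 = r%:R by rewrite sqr_sqrtr // ltW.
have s0 : s != 0 by rewrite -sqrf_eq0 s2 gt_eqF.
exists (fun i k => X k i / s) => t.
pose q k := \sum_i \sum_j Q t i j * (X k i * X k j).
have T0 : 0 < #|T|%:R :> R by rewrite ltr0n; apply/card_gt0P; exists t.
have E1 : expR (l * (\sum_k q k - r%:R * \sum_i Q t i i)) <=
    expR (ln #|T|%:R + 8 * l ^+ 2 * r%:R).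
  apply: le_trans (le_trans hX _).
    rewrite (bigD1 t) //= mul1r -[leLHS]addr0; apply: lerD.
      rewrite ler_expR sumrB mulrBr lerB //.
        rewrite mulr_sumr; apply: ler_sum => k _.
        rewrite mulr_sumr; apply: ler_sum => i _.
        rewrite mulr_sumr; apply: ler_sum => j _; by rewrite /P -mulrA.
      by rewrite sumr_const card_ord -mulr_sumr -mulr_natl; lra.
    by apply: sumr_ge0 => u _; rewrite mul1r expR_ge0.
  rewrite expRD lnK ?posrE // -sum1_card natr_sum mulr_suml.
  apply: ler_sum => u _; rewrite ler_wpM2l // -expRM_natl ler_expR.
  by rewrite mulrC ler_wpM2r ?ler0n // ler_wpM2l.
move: E1; rewrite ler_expR => E1.
have -> : \sum_k \sum_i \sum_j Q t i j * (X k i / s * (X k j / s)) =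
    (\sum_k q k) / r%:R.
  rewrite mulr_suml; apply: eq_bigr => k _; rewrite mulr_suml.
  apply: eq_bigr => i _; rewrite mulr_suml; apply: eq_bigr => j _.
  by rewrite -s2; field.
rewrite ler_pdivrMr //.
have : l * (\sum_k q k - r%:R * \sum_i Q t i i) <= l * (delta * r%:R).
  (* [ln |T|] is at most [delta^2 r / 40] and [8 l^2 r] is [delta^2 r / 50]; their sum stays below
     [l delta r = delta^2 r / 20]. *)
  apply: le_trans E1 _; rewrite /l; nra.
rewrite ler_pM2l // => h; lra.
Qed.

(** The squared Frobenius norm of [M Y] is the quadratic form of [M^T M] summed over the columns of
    [Y], so that norms of projected slices are controlled by the projection of forms. *)
Lemma gram_quadratic (R : realType) (q p r : nat) (M : 'I_q -> 'I_p -> R)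
    (Y : 'I_p -> 'I_r -> R) :
  \sum_a \sum_c (\sum_i M a i * Y i c) ^+ 2 =
  \sum_c \sum_i \sum_j (\sum_a M a i * M a j) * (Y i c * Y j c).
Proof.
rewrite exchange_big /=; apply: eq_bigr => c _.
under eq_bigr => a _ do rewrite expr2 big_distrlr /=.
rewrite exchange_big /=; apply: eq_bigr => i _.
rewrite exchange_big /=; apply: eq_bigr => j _.
by rewrite mulr_suml; apply: eq_bigr => a _; ring.
Qed.

Lemma gram_frobenius (R : realType) (q p : nat) (M : 'I_q -> 'I_p -> R) :
  \sum_i \sum_j (\sum_a M a i * M a j) ^+ 2 <= (\sum_a \sum_i M a i ^+ 2) ^+ 2.
Proof.
rewrite [in leRHS]exchange_big [leRHS]expr2 big_distrlr /=.
apply: ler_sum => i _; apply: ler_sum => j _.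
exact: sum_cauchy_schwarz.
Qed.

(** Each index contributes four forms of Frobenius norm at most 1: both signs of the symmetrized
    [u v^T / C], for the two-sided estimate, and the Gram matrices of [M] and [M'] divided by [D].
    The latter have trace at most 1, which together with [delta <= 1] gives the factor 2. *)
Lemma bilinear_projection (R : realType) (T : finType) (p r q q' : nat)
    (delta C D : R) (u v : T -> 'I_p -> R) (M : T -> 'I_q -> 'I_p -> R)
    (M' : T -> 'I_q' -> 'I_p -> R) :
  0 < delta -> delta <= 1 -> (0 < r)%N -> 0 < C -> 0 < D ->
  40 * ln ((4 * #|T|)%:R : R) <= delta ^+ 2 * r%:R ->
  (forall t, \sum_i u t i ^+ 2 <= C) -> (forall t, \sum_i v t i ^+ 2 <= C) ->
  (forall t, \sum_a \sum_i M t a i ^+ 2 <= D) ->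
  (forall t, \sum_a \sum_i M' t a i ^+ 2 <= D) ->
  exists Y : 'I_p -> 'I_r -> R, forall t,
    [/\ `|\sum_c (\sum_i u t i * Y i c) * (\sum_i v t i * Y i c)
          - \sum_i u t i * v t i| <= delta * C,
        \sum_a \sum_c (\sum_i M t a i * Y i c) ^+ 2 <= 2 * D &
        \sum_a \sum_c (\sum_i M' t a i * Y i c) ^+ 2 <= 2 * D].
Proof.
move=> d0 d1 r0 C0 D0 hr uC vC MD MD'.
pose pair t i j := (u t i * v t j + v t i * u t j) / (2 * C).
pose gram q0 (N : 'I_q0 -> 'I_p -> R) i j := (\sum_a N a i * N a j) / D.
pose Q (te : T * (bool * bool)) := match te.2 with
  | (false, false) => pair te.1 | (false, true) => fun i j => - pair te.1 i j
  | (true, false) => gram q (M te.1) | (true, true) => gram q' (M' te.1) end.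
have pair_le t : \sum_i \sum_j pair t i j ^+ 2 <= 1.
  have -> : \sum_i \sum_j pair t i j ^+ 2 =
      (\sum_i \sum_j (u t i * v t j + v t i * u t j) ^+ 2) / (2 * C) ^+ 2.
    rewrite mulr_suml; apply: eq_bigr => i _; rewrite mulr_suml.
    by apply: eq_bigr => j _; rewrite expr_div_n.
  rewrite ler_pdivrMr ?exprn_gt0 ?mulr_gt0 // mul1r.
  apply: le_trans (_ : _ <= 4 * ((\sum_i u t i ^+ 2) * (\sum_i v t i ^+ 2))) _.
    have -> : 4 * ((\sum_i u t i ^+ 2) * (\sum_i v t i ^+ 2)) =
      2 * (\sum_i \sum_j u t i ^+ 2 * v t j ^+ 2)
      + 2 * (\sum_i \sum_j v t i ^+ 2 * u t j ^+ 2).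
      by rewrite -!big_distrlr /=; ring.
    rewrite !mulr_sumr -big_split; apply: ler_sum => i _.
    rewrite !mulr_sumr -big_split; apply: ler_sum => j _ /=.
    by have := sqr_ge0 (u t i * v t j - v t i * u t j); lra.
  rewrite exprMn expr2; have := uC t; have := vC t.
  have : 0 <= \sum_i u t i ^+ 2 by apply: sumr_ge0 => i _; exact: sqr_ge0.
  have : 0 <= \sum_i v t i ^+ 2 by apply: sumr_ge0 => i _; exact: sqr_ge0.
  by nra.
have gram_le q0 (N : 'I_q0 -> 'I_p -> R) : \sum_a \sum_i N a i ^+ 2 <= D ->
    \sum_i \sum_j gram q0 N i j ^+ 2 <= 1.
  move=> ND; have -> : \sum_i \sum_j gram q0 N i j ^+ 2 =
      (\sum_i \sum_j (\sum_a N a i * N a j) ^+ 2) / D ^+ 2.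
    rewrite mulr_suml; apply: eq_bigr => i _; rewrite mulr_suml.
    by apply: eq_bigr => j _; rewrite expr_div_n.
  rewrite ler_pdivrMr ?exprn_gt0 // mul1r.
  apply: le_trans (gram_frobenius _) _; rewrite ler_sqr ?nnegrE ?(ltW D0) //.
  by apply: sumr_ge0 => a _; apply: sumr_ge0 => i _; exact: sqr_ge0.
have [|||Y hY] := @projection_preserving_forms R (T * (bool * bool))%type p r delta Q d0 d1 r0.
- by rewrite !card_prod card_bool mulnC.
- have pairC t i j : pair t i j = pair t j i by rewrite /pair; ring.
  have gramC q0 (N : 'I_q0 -> 'I_p -> R) i j : gram q0 N i j = gram q0 N j i.
    by rewrite /gram; congr (_ / _); apply: eq_bigr => a _; ring.
  by case=> t [[] []] i j; rewrite /Q //= pairC.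
- case=> t [[] []]; rewrite /Q /=; try exact: gram_le; last exact: pair_le.
  by under eq_bigr => i _ do under eq_bigr => j _ do rewrite sqrrN; exact: pair_le.
exists Y => t.
pose B := \sum_c (\sum_i u t i * Y i c) * (\sum_i v t i * Y i c).
have pairE : \sum_c \sum_i \sum_j pair t i j * (Y i c * Y j c) = B / C.
  rewrite /B mulr_suml; apply: eq_bigr => c _.
  have -> : (\sum_i u t i * Y i c) * (\sum_i v t i * Y i c) / C =
    ((\sum_i u t i * Y i c) * (\sum_i v t i * Y i c)
      + (\sum_i v t i * Y i c) * (\sum_i u t i * Y i c)) / (2 * C).
    by field; rewrite gt_eqF.
  rewrite !big_distrlr -big_split mulr_suml; apply: eq_bigr => i _ /=.
  rewrite -big_split mulr_suml; apply: eq_bigr => j _ /=.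
  by rewrite /pair; ring.
have gram_bound q0 (N : 'I_q0 -> 'I_p -> R) : \sum_a \sum_i N a i ^+ 2 <= D ->
    \sum_c \sum_i \sum_j gram q0 N i j * (Y i c * Y j c) <=
      \sum_i gram q0 N i i + delta ->
    \sum_a \sum_c (\sum_i N a i * Y i c) ^+ 2 <= 2 * D.
  move=> ND; rewrite gram_quadratic.
  have -> : \sum_c \sum_i \sum_j gram q0 N i j * (Y i c * Y j c) =
      (\sum_c \sum_i \sum_j (\sum_a N a i * N a j) * (Y i c * Y j c)) / D.
    rewrite mulr_suml; apply: eq_bigr => c _; rewrite mulr_suml.
    apply: eq_bigr => i _; rewrite mulr_suml; apply: eq_bigr => j _.
    by rewrite /gram; ring.
  rewrite ler_pdivrMr // => h; apply: le_trans h _.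
  rewrite mulrDl; have -> : (\sum_i gram q0 N i i) * D = \sum_a \sum_i N a i ^+ 2.
    rewrite /gram -mulr_suml divfK ?gt_eqF // exchange_big.
    by apply: eq_bigr => i _; apply: eq_bigr => a _; rewrite expr2.
  by nra.
split; last 2 first.
- by apply: gram_bound (MD t) _; exact: (hY (t, (true, false))).
- by apply: gram_bound (MD' t) _; exact: (hY (t, (true, true))).
have trE : \sum_i pair t i i = (\sum_i u t i * v t i) / C.
  rewrite mulr_suml; apply: eq_bigr => i _; rewrite /pair; field.
  by rewrite gt_eqF.
have := hY (t, (false, false)); rewrite /Q /= pairE trE => h1.
have := hY (t, (false, true)); rewrite /Q /= sumrN trE => h2.
have {}h2 : - (B / C) <= - ((\sum_i u t i * v t i) / C) + delta.
  rewrite -pairE; apply: le_trans h2; rewrite -sumrN; apply: ler_sum => c _.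
  rewrite -sumrN; apply: ler_sum => i _; rewrite -sumrN; apply: ler_sum => j _.
  by rewrite mulNr.
rewrite ler_norml -/B -lerN2 opprK.
have eB : B = B / C * C by rewrite divfK // gt_eqF.
have eS : \sum_i u t i * v t i = (\sum_i u t i * v t i) / C * C.
  by rewrite divfK // gt_eqF.
rewrite eB eS; move: h1 h2; set b := B / C; set s := (_ / C).
by move=> h1 h2; apply/andP; split; nra.
Qed.

(** * Tensor trains with natural number indices *)

Section Chains.
Variables (R : realType).
Implicit Types (rk : nat -> nat) (F : nat -> nat -> nat -> R).

(* [F s a b] is the entry [(a, b)] of the slice of core [s] selected by a fixed
   multi-index; [lft] and [rgt] are the partial products on the two sides of bond
   [k], of which [rgt] covers the cores [k, ..., k + m - 1]. The values outside
   the bond dimensions [rk] are never summed. *)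
Fixpoint lft rk F (k b : nat) : R :=
  if k is j.+1 then \sum_(a < rk j) lft rk F j a * F j a b else 1.

Fixpoint rgt rk F (m k a : nat) : R :=
  if m is j.+1 then \sum_(b < rk k.+1) F k a b * rgt rk F j k.+1 b else 1.

Lemma rgtS rk F (m k a : nat) :
  rgt rk F m.+1 k a = \sum_(b < rk k.+1) F k a b * rgt rk F m k.+1 b.
Proof. by []. Qed.

Definition contraction rk F d : R := \sum_(a < rk 0%N) rgt rk F d 0 a.

Lemma contraction_split rk F k m :
  contraction rk F (k + m) = \sum_(a < rk k) lft rk F k a * rgt rk F m k a.
Proof.
rewrite /contraction; elim: k m => [|k IH] m.
  by apply: eq_bigr => a _; rewrite mul1r.
rewrite addSnnS IH /=.
under eq_bigr => a _ do rewrite mulr_sumr.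
rewrite exchange_big; apply: eq_bigr => b _ /=; rewrite mulr_suml.
by apply: eq_bigr => a _; rewrite mulrA.
Qed.

Lemma eq_lft rk rk' F F' k (b : nat) :
  (forall s, (s < k)%N -> rk s = rk' s) ->
  (forall s a b, (s < k)%N -> F s a b = F' s a b) ->
  lft rk F k b = lft rk' F' k b.
Proof.
elim: k b => [//|k IH] b hrk hF /=; rewrite -hrk //.
apply: eq_bigr => a _; rewrite hF // IH // => s *; [apply: hrk|apply: hF];
  exact: ltnW.
Qed.

Lemma eq_rgt rk rk' F F' m k (a : nat) :
  (forall s, (k < s)%N -> rk s = rk' s) ->
  (forall s a b, (k <= s)%N -> F s a b = F' s a b) ->
  rgt rk F m k a = rgt rk' F' m k a.
Proof.
elim: m k a => [//|m IH] k a hrk hF /=; rewrite -hrk //.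
apply: eq_bigr => b _; rewrite hF // (IH k.+1) // => s *;
  [apply: hrk|apply: hF]; exact: ltnW.
Qed.

Lemma rgt_scale rk F (g : nat -> R) m k (a : nat) :
  rgt rk (fun s a b => g s * F s a b) m k a =
  (\prod_(k <= s < k + m) g s) * rgt rk F m k a.
Proof.
elim: m k a => [|m IH] k a; first by rewrite addn0 big_geq //= mulr1.
rewrite /= mulr_sumr; apply: eq_bigr => b _.
rewrite IH addSnnS [in RHS]big_ltn; last by rewrite addnS ltnS leq_addr.
by rewrite /=; ring.
Qed.

(** Multilinearity in the cores, by which they are normalized before the compression and scaled back
    after it. *)
Lemma contraction_scale rk F (g : nat -> R) d :
  contraction rk (fun s a b => g s * F s a b) d =
  (\prod_(s < d) g s) * contraction rk F d.
Proof.
rewrite /contraction mulr_sumr; apply: eq_bigr => a _.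
by rewrite rgt_scale add0n big_mkord.
Qed.

Lemma lft_frobenius rk F c k :
  rk 0%N = 1%N -> 0 <= c ->
  (forall s, (s < k)%N -> \sum_(a < rk s) \sum_(b < rk s.+1) F s a b ^+ 2 <= c) ->
  \sum_(b < rk k) lft rk F k b ^+ 2 <= c ^+ k.
Proof.
move=> rk0 c0; elim: k => [|k IH] hF.
  by rewrite rk0 big_ord1 expr1n expr0.
apply: le_trans (_ : _ <= (\sum_(a < rk k) lft rk F k a ^+ 2) *
   \sum_(a < rk k) \sum_(b < rk k.+1) F k a b ^+ 2) _.
  rewrite exchange_big mulr_sumr; apply: ler_sum => b _.
  exact: sum_cauchy_schwarz.
rewrite exprSr ler_pM ?hF ?IH //.
- by apply: sumr_ge0 => a _; exact: sqr_ge0.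
- by apply: sumr_ge0 => a _; apply: sumr_ge0 => b _; exact: sqr_ge0.
- by move=> s sk; apply: hF; exact: ltnW.
Qed.

(** Submultiplicativity of the Frobenius norm. The bound may vary with the core, so that the product
    of the core norms bounds the entries of a tensor. *)
Lemma rgt_frobenius rk F (c : nat -> R) m k :
  rk (k + m)%N = 1%N ->
  (forall s, (k <= s < k + m)%N ->
    \sum_(a < rk s) \sum_(b < rk s.+1) F s a b ^+ 2 <= c s) ->
  \sum_(a < rk k) rgt rk F m k a ^+ 2 <= \prod_(k <= s < k + m) c s.
Proof.
elim: m k => [|m IH] k rk1 hF.
  by rewrite big_geq; move: rk1; rewrite addn0 // => ->; rewrite big_ord1 expr1n.
have Sk : (k <= k < k + m.+1)%N by rewrite leqnn addnS ltnS leq_addr.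
rewrite -addSnnS in rk1 hF Sk *.
apply: le_trans (_ : _ <= (\sum_(a < rk k) \sum_(b < rk k.+1) F k a b ^+ 2) *
   \sum_(b < rk k.+1) rgt rk F m k.+1 b ^+ 2) _.
  by rewrite mulr_suml; apply: ler_sum => a _; exact: sum_cauchy_schwarz.
rewrite big_ltn //; last by case/andP: Sk.
rewrite ler_pM ?hF ?IH //.
- by apply: sumr_ge0 => a _; apply: sumr_ge0 => b _; exact: sqr_ge0.
- by apply: sumr_ge0 => a _; exact: sqr_ge0.
- by move=> s /andP[ks sk]; apply: hF; rewrite (ltnW ks).
Qed.

(** * Insertion of a matrix factor at one bond *)

Definition subst_rk k h rk j : nat := if j == k then h else rk j.

(** The factor [Y Z] enters at bond [k]: core [k - 1] absorbs [Y] on its right, core [k] absorbs [Z]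
    on its left. The sums run over the old dimension [rk k]. *)
Definition subst_core k (Y Z : nat -> nat -> R) rk F s a b : R :=
  if s.+1 == k then \sum_(c < rk k) F s a c * Y c b
  else if s == k then \sum_(c < rk k) Z a c * F s c b else F s a b.

Lemma subst_rk_eq k h rk : subst_rk k h rk k = h.
Proof. by rewrite /subst_rk eqxx. Qed.

Lemma subst_rk_neq k h rk j : j != k -> subst_rk k h rk j = rk j.
Proof. by rewrite /subst_rk => /negPf ->. Qed.

Lemma contraction_subst k h Y Z rk F d : (0 < k < d)%N ->
  contraction (subst_rk k h rk) (subst_core k Y Z rk F) d =
  \sum_(c < h) (\sum_(a < rk k) lft rk F k a * Y a c) *
               (\sum_(b < rk k) Z c b * rgt rk F (d - k) k b).
Proof.
case: k => [//|k] /= kd.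
rewrite -{1}(subnKC (ltnW kd)) contraction_split subst_rk_eq.
apply: eq_bigr => c _; congr (_ * _).
  rewrite /= subst_rk_neq ?ltn_eqF //; under [RHS]eq_bigr => a _ do rewrite mulr_suml.
  rewrite exchange_big; apply: eq_bigr => a _.
  rewrite /subst_core eqxx mulr_sumr; apply: eq_bigr => e _; rewrite mulrA.
  congr (_ * _ * _); apply: eq_lft => s; first by move=> sk; rewrite subst_rk_neq ?ltn_eqF // ltnS ltnW.
  by move=> a' b' sk; rewrite eqSS !ltn_eqF // ltnS ltnW.
have -> : (d - k.+1)%N = (d - k.+2).+1 by rewrite -subnSK.
rewrite /= subst_rk_neq ?gtn_eqF //; under [RHS]eq_bigr => a _ do rewrite mulr_sumr.
rewrite exchange_big; apply: eq_bigr => b _.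
rewrite /subst_core eqxx gtn_eqF // mulr_suml; apply: eq_bigr => e _; rewrite mulrA.
congr (_ * _); apply: eq_rgt => s; first by move=> sk; rewrite subst_rk_neq ?gtn_eqF // ltnW.
by move=> a' b' sk; rewrite eqSS !gtn_eqF // ltnW.
Qed.

End Chains.

(** * Translation from and to the TT format *)

Section BondSums.
Variables (d : nat) (m : 'I_d.+1 -> nat).

(** Plain natural numbers as values keep the case distinction on [unlift] free of the dependent
    bound [m k]. *)
Definition dcons_val (a : nat) (beta : 'I_d -> nat) (k : 'I_d.+1) : nat :=
  if unlift ord0 k is Some j then beta j else a.

Lemma dcons_proof (a : 'I_(m ord0))
    (beta : {dffun forall k : 'I_d, 'I_(m (lift ord0 k))}) (k : 'I_d.+1) :
  (dcons_val a (fun j => beta j) k < m k)%N.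
Proof. by rewrite /dcons_val; case: unliftP => [j ->|->]; exact: ltn_ord. Qed.

Definition dcons (a : 'I_(m ord0))
    (beta : {dffun forall k : 'I_d, 'I_(m (lift ord0 k))}) :
    {dffun forall k : 'I_d.+1, 'I_(m k)} :=
  finfun (fun k => Ordinal (dcons_proof a beta k)).

Lemma dcons0 a beta : dcons a beta ord0 = a.
Proof. by apply: val_inj; rewrite ffunE /= /dcons_val unlift_none. Qed.

Lemma dconsS a beta j : dcons a beta (lift ord0 j) = beta j.
Proof. by apply: val_inj; rewrite ffunE /= /dcons_val liftK. Qed.

Lemma sum_dffun_recl (V : nmodType) (f : {dffun forall k, 'I_(m k)} -> V) :
  \sum_alpha f alpha = \sum_a \sum_beta f (dcons a beta).
Proof.
rewrite pair_big /= (reindex (fun ab => dcons ab.1 ab.2)) //=.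
exists (fun alpha => (alpha ord0, finfun (fun j => alpha (lift ord0 j)))).
  move=> [a beta] _ /=; rewrite dcons0; congr (_, _).
  by apply/ffunP => j; rewrite ffunE dconsS.
move=> alpha _ /=; apply/ffunP => k; case: (unliftP ord0 k) => [j ->|->].
  by rewrite dconsS ffunE.
by rewrite dcons0.
Qed.

End BondSums.

Lemma rgt_shift (R : realType) (rk : nat -> nat) (F : nat -> nat -> nat -> R)
    (m k a : nat) :
  rgt (fun j => rk j.+1) (fun s => F s.+1) m k a = rgt rk F m k.+1 a.
Proof.
by elim: m k a => [//|m IH] k a /=; apply: eq_bigr => b _; rewrite IH.
Qed.

Arguments rgt : simpl never.

(** The weight carries the induction on [d]: once the first bond index is fixed to [a], the first
    core becomes the weight [F 0 a] of the remaining train. *)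
Lemma sum_bonds_weighted (R : realType) (d : nat) (rk' : 'I_d.+1 -> nat)
    (rk : nat -> nat) (F : nat -> nat -> nat -> R) (w : nat -> R) :
  (forall k, rk' k = rk k) ->
  \sum_(alpha : {dffun forall k : 'I_d.+1, 'I_(rk' k)})
    w (alpha ord0) * \prod_(s < d) F s (alpha (lbond s)) (alpha (rbond s)) =
  \sum_(a < rk 0%N) w a * rgt rk F d 0 a.
Proof.
elim: d rk' rk F w => [|d IH] rk' rk F w hrk.
  rewrite sum_dffun_recl -(hrk ord0); apply: eq_bigr => a _.
  under eq_bigr => beta _ do rewrite big_ord0 dcons0.
  rewrite sumr_const card_dep_ffun; set l := [seq _ | _ : _].
  have -> // : l = [::] by apply: size0nil; rewrite size_map -cardE card_ord.
rewrite sum_dffun_recl -(hrk ord0); apply: eq_bigr => a _.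
pose F1 s := F s.+1.
pose rk1 j := rk j.+1.
rewrite [rgt _ _ _ _ _](_ : _ = \sum_(b < rk1 0%N) F 0%N a b * rgt rk1 F1 d 0 b);
  last by apply: eq_bigr => b _; rewrite rgt_shift.
rewrite -(IH (fun k => rk' (lift ord0 k))); last first.
  by move=> k; rewrite hrk lift0.
rewrite mulr_sumr; apply: eq_bigr => beta _.
rewrite dcons0; congr (_ * _); rewrite big_ord_recl.
have valE k : dcons a beta k = dcons_val a (fun j => beta j) k :> nat.
  by rewrite ffunE.
rewrite !valE; congr (F _ _ _ * _).
- by rewrite (_ : lbond ord0 = ord0) ?/dcons_val ?unlift_none //; exact: val_inj.
- by rewrite /dcons_val liftK.
apply: eq_bigr => s _; rewrite !valE /F1 lift0; congr (F _ _ _).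
  rewrite (_ : lbond (lift ord0 s) = lift ord0 (lbond s)); last exact: val_inj.
  by rewrite /dcons_val liftK.
by rewrite /dcons_val liftK.
Qed.

Lemma sum_bonds (R : realType) (d : nat) (rk' : 'I_d.+1 -> nat)
    (rk : nat -> nat) (F : nat -> nat -> nat -> R) :
  (forall k, rk' k = rk k) ->
  \sum_(alpha : {dffun forall k : 'I_d.+1, 'I_(rk' k)})
    \prod_(s < d) F s (alpha (lbond s)) (alpha (rbond s)) = contraction rk F d.
Proof.
move=> hrk; rewrite /contraction.
under [RHS]eq_bigr => a _ do rewrite -[rgt _ _ _ _ _]mul1r.
rewrite -(@sum_bonds_weighted R d rk' rk F (fun=> 1)) //.
by apply: eq_bigr => alpha _; rewrite mul1r.
Qed.

Definition mode (d : nat) (n : 'I_d -> nat) (I : multi_index n) (s : nat) : nat :=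
  if insub s is Some s' then val (I s') else 0%N.

Lemma modeE (d : nat) (n : 'I_d -> nat) (I : multi_index n) (s : 'I_d) :
  mode I s = I s.
Proof. by rewrite /mode valK. Qed.

Definition flat_rk (R : realType) (d : nat) (n : 'I_d -> nat)
  (G : tt_cores R n) (k : nat) : nat := tt_rk G (inord k).

Definition flat_core (R : realType) (d : nat) (n : 'I_d -> nat)
    (G : tt_cores R n) (s i a b : nat) : R :=
  if insub s is Some s' then
    if (insub a, insub i, insub b) is (Some a', Some i', Some b')
    then tt_core G s' a' i' b' else 0
  else 0.

Lemma flat_coreE (R : realType) (d : nat) (n : 'I_d -> nat)
    (G : tt_cores R n) (s : 'I_d) i a b :
  flat_core G s (nat_of_ord i) (nat_of_ord a) (nat_of_ord b) = tt_core G s a i b.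
Proof. by rewrite /flat_core valK !valK. Qed.

Lemma TT_flat (R : realType) (d : nat) (n : 'I_d -> nat) (G : tt_cores R n)
    (I : multi_index n) :
  TT G I = contraction (flat_rk G) (fun s => flat_core G s (mode I s)) d.
Proof.
rewrite ffunE -(@sum_bonds R d (tt_rk G)); last first.
  by move=> k; rewrite /flat_rk inord_val.
apply: eq_bigr => alpha _; apply: eq_bigr => s _.
by rewrite modeE flat_coreE.
Qed.

Lemma flat_rk_first (R : realType) (d : nat) (n : 'I_d -> nat)
  (G : tt_cores R n) : flat_rk G 0 = 1%N.
Proof. by rewrite -(tt_rk_first G) /flat_rk -[ord0]inord_val. Qed.

Lemma flat_rk_last (R : realType) (d : nat) (n : 'I_d -> nat)
  (G : tt_cores R n) : flat_rk G d = 1%N.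
Proof. by rewrite -(tt_rk_last G) /flat_rk -[ord_max]inord_val. Qed.

Section Unflatten.
Variables (R : realType) (d : nat) (n : 'I_d -> nat) (rk : nat -> nat)
  (C : nat -> nat -> nat -> nat -> R).
Hypotheses (rk_gt0 : forall k, (0 < rk k)%N) (rk_first : rk 0%N = 1%N)
  (rk_last : rk d = 1%N).

Definition unflatten : tt_cores R n :=
  @TTCores R d n (fun k : 'I_d.+1 => rk k) (fun k => rk_gt0 k) rk_first rk_last
    (fun s a i b => C s i a b).

Lemma TT_unflatten (I : multi_index n) :
  TT unflatten I = contraction rk (fun s => C s (mode I s)) d.
Proof.
rewrite ffunE -(@sum_bonds R d (fun k : 'I_d.+1 => rk k)) //.
by apply: eq_bigr => alpha _; apply: eq_bigr => s _; rewrite modeE.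
Qed.

End Unflatten.

(* Every inner bond carries a multi-index [J], copied along the train; core [s]
   tests [J s = I s] and the last core multiplies by [A J]. *)
Lemma tensor_has_TT (R : realType) (d : nat) (n : 'I_d -> nat) (A : tensor R n) :
  (2 <= d)%N -> (forall s, (0 < n s)%N) -> exists G : tt_cores R n, TT G = A.
Proof.
move=> d2 n0.
pose I0 : multi_index n := finfun (fun s => Ordinal (n0 s)).
pose J c := nth I0 (enum {: multi_index n}) c.
pose N := #|{: multi_index n}|.
have N0 : (0 < N)%N by apply/card_gt0P; exists I0.
pose rk k := if (0 < k < d)%N then N else 1%N.
(* Core 0 reads the multi-index from its right bond, as its left bond is trivial. The test [a == b]
   copies it along the train and is waived at both ends, where one of the bonds has dimension 1. *)
pose C s i a b : R := (mode (J (if s == 0 then b else a)%N) s == i)%:R *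
  ((s == 0) || (s.+1 == d) || (a == b))%N%:R * (if s.+1 == d then A (J a) else 1).
have rk0 : rk 0%N = 1%N by [].
have rkd : rk d = 1%N by rewrite /rk ltnn andbF.
have rkgt k : (0 < rk k)%N by rewrite /rk; case: ifP.
have rkin k : (0 < k < d)%N -> rk k = N by rewrite /rk => ->.
exists (unflatten n C rkgt rk0 rkd); apply/ffunP => I; rewrite TT_unflatten.
have tail m k a : (0 < k)%N -> (k + m.+1)%N = d -> (a < N)%N ->
    rgt rk (fun s => C s (mode I s)) m.+1 k a =
    A (J a) * \prod_(k <= s < d) (mode (J a) s == mode I s)%:R.
  elim: m k a => [|m IH] k a k0 kd aN.
    rewrite addn1 in kd.
    have -> f : \prod_(k <= s < d) f s = f k :> R by rewrite -kd big_nat1.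
    rewrite rgtS kd rkd big_ord1 mulr1 /C.
    by rewrite (gtn_eqF k0) kd eqxx /= mulr1 mulrC.
  have kd1 : (k.+1 < d)%N by rewrite -kd -addSnnS addnS ltnS leq_addr.
  rewrite rgtS rkin //.
  rewrite (bigD1 (Ordinal aN)) //= [X in _ + X]big1 ?addr0 => [|b ba].
    have -> : C k (mode I k) a (Ordinal aN) = (mode (J a) k == mode I k)%:R.
      by rewrite /C (gtn_eqF k0) eqxx orbT (ltn_eqF kd1) !mulr1.
    rewrite IH //; last by rewrite addSnnS.
    rewrite [in RHS]big_ltn; last exact: ltnW.
    by rewrite /=; ring.
  have {}ba : (a == b :> nat) = false.
    by apply/negbTE; apply: contra ba => /eqP ab; apply/eqP/val_inj.
  by rewrite /C ba (gtn_eqF k0) (ltn_eqF kd1) /= mulr0 !mul0r.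
have dE : d.-1 = d.-2.+1 by case: (d) d2 => [|[]].
have head F a : rgt rk F d 0 a = \sum_(b < rk 1%N) F 0%N a b * rgt rk F d.-1 1 b.
  by rewrite -[in LHS](ltn_predK d2).
rewrite /contraction rk0 big_ord1 head dE rkin //.
have tail1 (b : 'I_N) : rgt rk (fun s => C s (mode I s)) d.-2.+1 1 b =
    A (J b) * \prod_(1 <= s < d) (mode (J b) s == mode I s)%:R.
  by apply: tail => //; rewrite -dE add1n (ltn_predK d2).
(* Only [K = I] passes the tests of all modes, so that the sum of [f] collapses to [A I]. *)
pose f K := A K * \prod_(s < d) (mode K s == mode I s)%:R.
transitivity (\sum_(b < N) f (J b)).
  apply: eq_bigr => b _; rewrite tail1 /C eqxx /= (ltn_eqF d2) !mulr1 /f.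
  rewrite -(big_mkord xpredT (fun s => (mode (J b) s == mode I s)%:R)).
  by rewrite [in RHS]big_ltn 1?ltnW //=; ring.
transitivity (\sum_K f K).
  rewrite -[in RHS]big_enum (big_nth I0) big_mkord.
  by rewrite -cardE.
rewrite (bigD1 I) //= {1}/f [X in _ * X]big1 => [|s _]; last by rewrite eqxx.
rewrite big1 ?addr0 ?mulr1 // => K KI.
suff [s sK] : exists s : 'I_d, (mode K s == mode I s) = false.
  by rewrite /f (bigD1 s) //= sK mul0r mulr0.
have /existsP[s /negPf sK] : [exists s : 'I_d, mode K s != mode I s].
  apply: contraNT KI => /existsPn h; apply/eqP/ffunP => s; apply/val_inj/eqP.
  by have := h s; rewrite !modeE negbK.
by exists s.
Qed.

(** * Existence of the TT rank *)

Definition nat_mx (R : realType) (p q : nat) (M : 'M[R]_(p, q)) (a b : nat) : R :=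
  if (insub a, insub b) is (Some a', Some b') then M a' b' else 0.

Lemma nat_mxE (R : realType) (p q : nat) (M : 'M[R]_(p, q)) (a : 'I_p) (b : 'I_q) :
  nat_mx M a b = M a b.
Proof. by rewrite /nat_mx !valK. Qed.

(** Rows and columns of an unfolding are both indexed by full multi-indices; a row uses the modes
    below [k], a column the others. The repeated rows and columns are harmless, and the index type
    is never split. *)
Definition glue (d : nat) (n : 'I_d -> nat) (k : nat) (I J : multi_index n) :
  multi_index n := finfun (fun s : 'I_d => if (s < k)%N then I s else J s).

Lemma mode_glue (d : nat) (n : 'I_d -> nat) (k : nat) (I J : multi_index n) s :
  mode (glue k I J) s = if (s < k)%N then mode I s else mode J s.
Proof.
rewrite /mode; case: insubP => [s' _ <-|_]; last by rewrite if_same.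
by rewrite ffunE; case: ifP.
Qed.

Section RankReduction.
Variables (R : realType) (d : nat) (n : 'I_d -> nat).
Implicit Types (rk : nat -> nat) (C : nat -> nat -> nat -> nat -> R).

Let row_chain C (I : multi_index n) s := C s (mode I s).

(* The contraction at a glued index is an entry of the unfolding of the tensor at
   bond [k]; hence that unfolding depends on the tensor only. *)
Lemma contraction_glue rk C k (I J : multi_index n) : (k <= d)%N ->
  contraction rk (row_chain C (glue k I J)) d =
  \sum_(a < rk k) lft rk (row_chain C I) k a * rgt rk (row_chain C J) (d - k) k a.
Proof.
move=> kd; have := contraction_split rk (row_chain C (glue k I J)) k (d - k).
rewrite subnKC // => ->; apply: eq_bigr => a _; congr (_ * _).
  by apply: eq_lft => // s b c sk; rewrite /row_chain mode_glue sk.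
by apply: eq_rgt => // s b c sk; rewrite /row_chain mode_glue ltnNge sk.
Qed.

(** A bond dimension reached at [k] by one factorization can be imposed on another one, whose other
    bonds keep their dimensions. *)
Lemma rank_transfer rk rk' C C' k : (0 < k < d)%N ->
  (forall I, contraction rk (row_chain C I) d = contraction rk' (row_chain C' I) d) ->
  exists Y Z, forall I,
    contraction (subst_rk k (rk' k) rk) (subst_core k Y Z rk (row_chain C I)) d =
    contraction rk (row_chain C I) d.
Proof.
move=> kd hC; have kd' : (k <= d)%N by case/andP: kd => _ /ltnW.
pose N := #|{: multi_index n}|.
pose L rk0 C0 : 'M[R]_(N, rk0 k) :=
  \matrix_(I, a) lft rk0 (row_chain C0 (enum_val I)) k a.
pose U rk0 C0 : 'M[R]_(rk0 k, N) :=
  \matrix_(a, J) rgt rk0 (row_chain C0 (enum_val J)) (d - k) k a.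
pose M := L rk C *m U rk C.
have ME : M = L rk' C' *m U rk' C'.
  apply/matrixP => I J; rewrite !mxE.
  have := hC (glue k (enum_val I) (enum_val J)).
  rewrite !contraction_glue // => h; apply: etrans (etrans h _).
    by apply: eq_bigr => a _; rewrite !mxE.
  by apply: eq_bigr => a _; rewrite !mxE.
have [P MK] : exists P, M *m P *m M = M.
  by exists (pinvmx M); apply: mulmxKpV; exact: submx_refl.
pose Y := U rk C *m P *m L rk' C'.
pose Z := U rk' C' *m P *m L rk C.
(* With [M = L U = L' U'] the product regroups to [M P M P M]. The diagonal entries of this identity
   are the entries of the tensor, as [glue k I I = I]. *)
have LYZU : L rk C *m Y *m (Z *m U rk C) = M.
  rewrite /Y /Z !mulmxA -/M -(mulmxA _ (L rk' C')) -ME MK.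
  by rewrite -(mulmxA _ (L rk C)) -/M MK.
exists (nat_mx Y), (nat_mx Z) => I.
have glueI : glue k I I = I by apply/ffunP => s; rewrite ffunE if_same.
rewrite contraction_subst // -[in RHS]glueI contraction_glue //.
have := congr1 (fun B : 'M_N => B (enum_rank I) (enum_rank I)) LYZU.
rewrite ![in X in X = _]mxE => h; apply: etrans (etrans h _).
  apply: eq_bigr => c _; rewrite !mxE; congr (_ * _).
    by apply: eq_bigr => a _; rewrite nat_mxE !mxE enum_rankK.
  by apply: eq_bigr => a _; rewrite nat_mxE !mxE enum_rankK.
by rewrite !mxE; apply: eq_bigr => a _; rewrite !mxE enum_rankK.
Qed.

End RankReduction.

(** The sum of the bond dimensions is the measure of the descent to the TT rank. The bond [k] is an
    inner one, as both trains have dimension 1 at the ends. *)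
Lemma lower_bond_rank (R : realType) (d : nat) (n : 'I_d -> nat)
    (G H : tt_cores R n) (k : 'I_d.+1) :
  TT H = TT G -> (tt_rk H k < tt_rk G k)%N ->
  exists2 G' : tt_cores R n, TT G' = TT G &
    (\sum_j tt_rk G' j < \sum_j tt_rk G j)%N.
Proof.
move=> HG hk.
have k0 : (0 < k)%N.
  rewrite lt0n; apply: contraTneq hk => k0.
  by rewrite (_ : k = ord0) ?tt_rk_first //; exact: val_inj.
have kd : (k < d)%N.
  rewrite ltn_neqAle -ltnS ltn_ord andbT; apply: contraTneq hk => kd.
  by rewrite (_ : k = ord_max) ?tt_rk_last //; exact: val_inj.
have kin : (0 < k < d)%N by rewrite k0.
have frk (K : tt_cores R n) (j : 'I_d.+1) : flat_rk K j = tt_rk K j.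
  by rewrite /flat_rk inord_val.
have [|Y [Z YZ]] := @rank_transfer R d n (flat_rk G) (flat_rk H)
  (flat_core G) (flat_core H) k kin.
  by move=> I; rewrite -!TT_flat HG.
pose rk := subst_rk k (flat_rk H k) (flat_rk G).
have rk_gt0 j : (0 < rk j)%N by rewrite /rk /subst_rk; case: ifP => _; exact: tt_rk_gt0.
have rk0 : rk 0%N = 1%N by rewrite /rk subst_rk_neq ?flat_rk_first // ltn_eqF.
have rkd : rk d = 1%N by rewrite /rk subst_rk_neq ?flat_rk_last // gtn_eqF.
pose C s i := subst_core k Y Z (flat_rk G) (fun s => flat_core G s i) s.
exists (unflatten n C rk_gt0 rk0 rkd).
  by apply/ffunP => I; rewrite TT_unflatten TT_flat -YZ.
rewrite [ltnLHS](bigD1 k) //= [ltnRHS](bigD1 k) //=.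
rewrite -addSn leq_add //; first by rewrite /rk subst_rk_eq frk.
apply: leq_sum => j jk; rewrite /rk subst_rk_neq ?frk //.
Qed.

(** A factorization that no other one beats at any bond has the componentwise smallest rank; the
    descent must end at such a factorization. *)
Lemma tt_rank_exists (R : realType) (d : nat) (n : 'I_d -> nat) (G : tt_cores R n) :
  exists rho, is_tt_rank (TT G) rho.
Proof.
have [m] := ubnP (\sum_j tt_rk G j); elim: m G => [//|m IH] G hG.
have [h|h] := pselect (exists H : tt_cores R n, exists2 k,
    TT H = TT G & (tt_rk H k < tt_rk G k)%N).
  have [H [k HG hk]] := h.
  have [G' <- lt] := lower_bond_rank HG hk.
  by apply: IH; apply: leq_trans lt _; rewrite -ltnS.
exists (tt_rk G); split; first by exists G.
move=> H HG k; rewrite leqNgt; apply/negP => lt.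
by apply: h; exists H, k.
Qed.

(** * Compression *)

Definition core_sq (R : realType) (rk : nat -> nat) (F : nat -> nat -> nat -> R)
  (s : nat) : R := \sum_(a < rk s) \sum_(b < rk s.+1) F s a b ^+ 2.

(** Induction over the bonds. Each bond at most doubles the squared norms of the slices next to it,
    whence [2 ^ k]. A product of at most [d] such slices has squared norm at most [2 ^ (d^2)], so
    each bond adds an error of at most [delta 2 ^ (d^2)]. *)
Lemma compress_bonds (R : realType) (d : nat) (n : 'I_d -> nat) (rk : nat -> nat)
    (C : nat -> nat -> nat -> nat -> R) (delta : R) (r k : nat) :
  (forall j, (0 < rk j)%N) -> rk 0%N = 1%N -> rk d = 1%N -> 0 < delta -> delta <= 1 -> (0 < r)%N ->
  40 * ln ((4 * #|{: multi_index n}|)%:R : R) <= delta ^+ 2 * r%:R ->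
  (forall (I : multi_index n) s, (s < d)%N ->
    core_sq rk (fun s => C s (mode I s)) s <= 1) ->
  (k < d)%N ->
  exists (rk' : nat -> nat) (C' : nat -> nat -> nat -> nat -> R),
    [/\ rk' 0%N = 1%N, rk' d = 1%N,
        forall j, (0 < rk' j)%N /\ ((0 < j <= k)%N -> rk' j = r),
        forall (I : multi_index n) s, (s < d)%N ->
          core_sq rk' (fun s => C' s (mode I s)) s <= 2 ^+ k &
        forall I : multi_index n,
          `|contraction rk' (fun s => C' s (mode I s)) d
            - contraction rk (fun s => C s (mode I s)) d|
          <= k%:R * (delta * 2 ^+ (d * d))].
Proof.
move=> rkgt0 rk0 rkd d0 d1 r0 hr hC; elim: k => [|k IH] kd.
  exists rk, C; split=> // [[|j]|I] //.
  by rewrite subrr normr0 mul0r.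
have {IH} [rk1 [C1 [rk10 rk1d rk1j C1le err]]] := IH (ltnW kd).
pose F (I : multi_index n) s := C1 s (mode I s).
set K := k.+1 in kd *.
pose u I (a : 'I_(rk1 K)) := lft rk1 (F I) K a.
pose v I (a : 'I_(rk1 K)) := rgt rk1 (F I) (d - K) K a.
have two1 : (1 : R) <= 2 by rewrite ler1n.
have pow_le m : (m <= d)%N -> (2 ^+ k) ^+ m <= (2 ^+ (d * d) : R).
  by move=> md; rewrite -exprM ler_weXn2l // leq_mul // ltnW // ltnW.
have [|||||||Y hY] := @bilinear_projection R (multi_index n) (rk1 K) r (rk1 k)
  (rk1 K.+1) delta (2 ^+ (d * d)) (2 ^+ k) u v (fun I a i => F I k a i)
  (fun I b i => F I K i b) d0 d1 r0.
- by rewrite exprn_gt0.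
- by rewrite exprn_gt0.
- by [].
- move=> I; apply: le_trans (pow_le K (ltnW kd)); apply: lft_frobenius => //.
    by rewrite exprn_ge0.
  by move=> s sK; apply: C1le; exact: ltn_trans kd.
- move=> I; apply: le_trans (pow_le (d - K)%N (leq_subr _ _)).
  have dK : (K + (d - K))%N = d by rewrite subnKC // ltnW.
  rewrite -[in leRHS](addKn K (d - K)%N) -prodr_const_nat.
  apply: rgt_frobenius; first by rewrite dK.
  by move=> s /andP[_]; rewrite dK => sd; exact: C1le.
- by move=> I; apply: C1le; rewrite ltnW.
(* Core [K] meets [Y] through its left index and therefore enters transposed. *)
- by move=> I; rewrite exchange_big; apply: C1le.
pose Ym : 'M[R]_(rk1 K, r) := \matrix_(i, c) Y i c.
pose Z c b := nat_mx Ym b c.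
exists (subst_rk K r rk1),
  (fun s i => subst_core K (nat_mx Ym) Z rk1 (fun s => C1 s i) s).
have Kin : (0 < K < d)%N by rewrite kd.
split.
- by rewrite subst_rk_neq.
- by rewrite subst_rk_neq // gtn_eqF.
- move=> j; have [j1 jr] := rk1j j; have [->|jK] := eqVneq j K.
    by rewrite subst_rk_eq.
  rewrite subst_rk_neq //; split=> // /andP[j0 jk]; apply: jr.
  by rewrite j0 -ltnS ltn_neqAle jK.
- move=> I s sd; rewrite /core_sq /subst_core; have [_ hM hM'] := hY I.
  have [/eqP sK|sK] := boolP (s.+1 == K).
    case: sK => ->; rewrite subst_rk_neq ?ltn_eqF // subst_rk_eq exprS.
    apply: le_trans hM; rewrite le_eqVlt; apply/orP; left; apply/eqP.
    apply: eq_bigr => a _; apply: eq_bigr => c _; congr (_ ^+ 2).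
    by apply: eq_bigr => i _; rewrite nat_mxE mxE.
  have [->|sK'] := eqVneq s K.
    rewrite subst_rk_eq subst_rk_neq ?gtn_eqF // exprS.
    apply: le_trans hM'; rewrite exchange_big le_eqVlt; apply/orP; left; apply/eqP.
    apply: eq_bigr => b _; apply: eq_bigr => c _; congr (_ ^+ 2).
    by apply: eq_bigr => i _; rewrite /Z nat_mxE mxE mulrC.
  rewrite !subst_rk_neq //; apply: le_trans (C1le I s sd) _.
  by rewrite ler_weXn2l.
move=> I; have [hB _ _] := hY I.
have E1 : contraction rk1 (F I) d = \sum_i u I i * v I i.
  have := contraction_split rk1 (F I) K (d - K).
  by rewrite subnKC // ltnW.
have E2 : contraction (subst_rk K r rk1)
    (fun s => subst_core K (nat_mx Ym) Z rk1 (fun s' => C1 s' (mode I s)) s) d =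
    \sum_c (\sum_i u I i * Y i c) * (\sum_i v I i * Y i c).
  apply: etrans (contraction_subst r (nat_mx Ym) Z rk1 (F I) Kin) _.
  apply: eq_bigr => c _; congr (_ * _); apply: eq_bigr => a _.
    by rewrite nat_mxE mxE.
  by rewrite /Z nat_mxE mxE mulrC.
rewrite E2; have := err I; rewrite -/(F I) -[contraction rk1 _ _]/(contraction rk1 (F I) d) E1.
move=> h; rewrite -(subrK (\sum_i u I i * v I i) (\sum_c _)) -addrA.
apply: le_trans (ler_normD _ _) _.
by rewrite [K%:R]mulrS mulrDl mul1r lerD.
Qed.

(** * Bounds in terms of the core norms *)

Lemma norm_Finf_ge0 (R : realType) (p n q : nat) (G : tensor3 R p n q) :
  0 <= norm_Finf G.
Proof.
rewrite /norm_Finf; elim/big_rec: _ => // i x _ x0.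
by rewrite le_max x0 orbT.
Qed.

Lemma core_sq_flat (R : realType) (d : nat) (n : 'I_d -> nat) (G : tt_cores R n)
    (I : multi_index n) (s : 'I_d) :
  core_sq (flat_rk G) (fun s => flat_core G s (mode I s)) s <=
  norm_Finf (tt_core G s) ^+ 2.
Proof.
have -> : core_sq (flat_rk G) (fun s => flat_core G s (mode I s)) s =
    frobenius_norm (slice (tt_core G s) (I s)) ^+ 2.
  rewrite sqr_sqrtr; last first.
    by apply: sumr_ge0 => a _; apply: sumr_ge0 => b _; exact: sqr_ge0.
  rewrite /core_sq.
  have -> : flat_rk G s = tt_rk G (lbond s).
    by rewrite /flat_rk; congr tt_rk; apply: val_inj; rewrite /= inordK // ltnW ?ltnS.
  have -> : flat_rk G s.+1 = tt_rk G (rbond s).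
    by rewrite /flat_rk; congr tt_rk; apply: val_inj; rewrite /= inordK // ltnS.
  by apply: eq_bigr => a _; apply: eq_bigr => b _; rewrite modeE flat_coreE mxE.
rewrite lerXn2r ?nnegrE ?norm_Finf_ge0 ?sqrtr_ge0 //.
exact: (le_bigmax 0 (fun i => frobenius_norm (slice (tt_core G s) i))).
Qed.

(** This makes the modulus of every entry a lower bound for the infimum in [gamma_TT], and forces
    the tensor to vanish as soon as one core norm does. *)
Lemma TT_entry_le (R : realType) (d : nat) (n : 'I_d -> nat) (G : tt_cores R n)
    (I : multi_index n) :
  `|TT G I| <= \prod_(s < d) norm_Finf (tt_core G s).
Proof.
have g0 : 0 <= \prod_(s < d) norm_Finf (tt_core G s).
  by apply: prodr_ge0 => s _; exact: norm_Finf_ge0.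
rewrite -ler_sqr ?nnegrE // real_normK ?num_real // TT_flat.
pose c s := if insub s is Some s' then norm_Finf (tt_core G s') ^+ 2 else 0.
have cE (s : 'I_d) : c s = norm_Finf (tt_core G s) ^+ 2 by rewrite /c valK.
rewrite -prodrXl -(eq_bigr _ (fun s _ => cE s)) -(big_mkord xpredT c).
apply: le_trans (_ : _ <= \sum_(a < flat_rk G 0)
  rgt (flat_rk G) (fun s => flat_core G s (mode I s)) d 0 a ^+ 2) _.
  by rewrite /contraction flat_rk_first !big_ord1.
apply: rgt_frobenius; first exact: flat_rk_last.
move=> s /= sd; rewrite -[s]/(nat_of_ord (Ordinal sd)) cE.
exact: core_sq_flat.
Qed.

Lemma card_multi_index (d : nat) (n : 'I_d -> nat) :
  #|{: multi_index n}| = (\prod_(s < d) n s)%N.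
Proof.
rewrite card_dep_ffun foldrE big_map enumT.
by apply: eq_bigr => s _; rewrite card_ord.
Qed.

Lemma tt_compression (R : realType) (d : nat) (n : 'I_d -> nat) (G : tt_cores R n)
    (delta : R) (r : nat) :
  (0 < d)%N -> 0 < delta -> delta <= 1 -> (0 < r)%N ->
  40 * ln ((4 * \prod_(s < d) n s)%:R : R) <= delta ^+ 2 * r%:R ->
  exists2 G' : tt_cores R n,
    forall k : 'I_d.+1, (0 < k < d)%N -> tt_rk G' k = r &
    forall I : multi_index n, `|TT G I - TT G' I| <=
      d%:R * (delta * 2 ^+ (d * d)) * \prod_(s < d) norm_Finf (tt_core G s).
Proof.
move=> d_gt0 d0 d1 r0 hr.
pose gam := \prod_(s < d) norm_Finf (tt_core G s).
have D0 : 0 <= d%:R * (delta * 2 ^+ (d * d)) by rewrite !mulr_ge0 // ?ltW // exprn_gt0.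
pose g s := if insub s is Some s' then norm_Finf (tt_core G s') else 0.
have gE (s : 'I_d) : g s = norm_Finf (tt_core G s) by rewrite /g valK.
(* Normalized cores; as [0^-1 = 0], a core of norm 0 becomes the zero core. *)
pose C s i a b := (g s)^-1 * flat_core G s i a b.
have gprod : \prod_(s < d) g s = gam by apply: eq_bigr => s _.
have C_le1 (I : multi_index n) s : (s < d)%N ->
    core_sq (flat_rk G) (fun s => C s (mode I s)) s <= 1.
  move=> sd; have := core_sq_flat G I (Ordinal sd); rewrite -gE /= => h.
  have -> : core_sq (flat_rk G) (fun s => C s (mode I s)) s =
    (g s)^-1 ^+ 2 * core_sq (flat_rk G) (fun s => flat_core G s (mode I s)) s.
    rewrite /core_sq mulr_sumr; apply: eq_bigr => a _.
    by rewrite mulr_sumr; apply: eq_bigr => b _; rewrite exprMn.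
  have [->|gs0] := eqVneq (g s) 0; first by rewrite invr0 expr0n mul0r ler01.
  by rewrite exprVn mulrC ler_pdivrMr ?mul1r // exprn_even_gt0.
have [||rk [C' [rk_first rk_last rkP _ err]]] := @compress_bonds R d n (flat_rk G) C delta r d.-1
  (fun j => tt_rk_gt0 G _) (flat_rk_first G) (flat_rk_last G) d0 d1 r0 _ C_le1.
- by rewrite card_multi_index.
- by rewrite prednK.
pose C'' s i a b := g s * C' s i a b.
exists (unflatten n C'' (fun j => (rkP j).1) rk_first rk_last).
  by move=> k /andP[k0 kd]; apply: (rkP k).2; rewrite k0 -ltnS prednK.
move=> I; rewrite TT_unflatten.
rewrite [X in _ - X](contraction_scale rk (fun s => C' s (mode I s)) g d) gprod.
(* If some core norm is 0, the rescaled train is zero, and so is [TT G] by the entrywise bound. *)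
have [gam0|gam0] := eqVneq gam 0.
  by rewrite gam0 mul0r subr0; have := TT_entry_le G I; rewrite -/gam gam0 mulr0.
have -> : TT G I = gam * contraction (flat_rk G) (fun s => C s (mode I s)) d.
  rewrite TT_flat -gprod -contraction_scale.
  apply: eq_bigr => a _; apply: eq_rgt => // s b c _.
  have [ds|sd] := leqP d s.
    by rewrite /C /flat_core insubF ?mulr0 // ltnNge ds.
  have gs0 : g s != 0.
    by rewrite -[s]/(nat_of_ord (Ordinal sd)) gE; move/prodf_neq0: gam0; exact.
  by rewrite /C mulVKf.
have gam_ge0 : 0 <= gam by apply: prodr_ge0 => s _; exact: norm_Finf_ge0.
rewrite -mulrBr normrM (ger0_norm gam_ge0) mulrC ler_wpM2r // distrC.
apply: le_trans (err I) _; rewrite ler_wpM2r ?mulr_ge0 ?(ltW d0) ?exprn_ge0 //.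
by rewrite ler_nat leq_pred.
Qed.

Lemma zero_TT (R : realType) (d : nat) (n : 'I_d -> nat) : (0 < d)%N ->
  exists2 G : tt_cores R n, TT G = 0 & forall k, tt_rk G k = 1%N.
Proof.
case: d n => // d n _.
exists (unflatten n (fun _ _ _ _ => 0 : R) (fun=> ltn0Sn 0) erefl erefl) => //.
apply/ffunP => I; rewrite TT_unflatten ffunE /contraction.
by rewrite big_ord1 rgtS big_ord1 mul0r.
Qed.

(** The infimum is approached up to an error of [gamma_TT A] itself, which is positive because a
    nonzero entry bounds it from below. *)
Lemma gamma_TT_near (R : realType) (d : nat) (n : 'I_d -> nat) (A : tensor R n) :
  (2 <= d)%N -> (forall s, (0 < n s)%N) -> A != 0 ->
  exists2 G : tt_cores R n,
    TT G = A & \prod_(s < d) norm_Finf (tt_core G s) <= 2 * gamma_TT A.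
Proof.
move=> d2 n0 A0; have [G GA] := tensor_has_TT A d2 n0.
have [I AI] : exists I, A I != 0.
  apply: contrapT => h; case/negP: A0; apply/eqP/ffunP => I; rewrite ffunE.
  by apply: contrapT => AI; apply: h; exists I; apply/eqP.
have lbA : lbound [set x : R | exists2 G : tt_cores R n,
    TT G = A & x = \prod_(s < d) norm_Finf (tt_core G s)]%classic `|A I|.
  by move=> _ [G' <- ->]; exact: TT_entry_le.
have ne : nonempty [set x : R | exists2 G : tt_cores R n,
    TT G = A & x = \prod_(s < d) norm_Finf (tt_core G s)]%classic by eexists; exists G.
have g0 : 0 < gamma_TT A.
  by apply: lt_le_trans (lb_le_inf ne lbA); rewrite normr_gt0.
have [_ [G' GA' ->] lt] := inf_adherent g0 (conj ne (ex_intro _ _ lbA)).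
by exists G' => //; rewrite mulr_natl mulr2n ltW.
Qed.

Lemma gamma_TT_ge0 (R : realType) (d : nat) (n : 'I_d -> nat) (A : tensor R n) :
  (2 <= d)%N -> (forall s, (0 < n s)%N) -> 0 <= gamma_TT A.
Proof.
move=> d2 n0; have [G GA] := tensor_has_TT A d2 n0.
apply: lb_le_inf; first by eexists; exists G.
by move=> _ [G' _ ->]; apply: prodr_ge0 => s _; exact: norm_Finf_ge0.
Qed.

Theorem theorem1p6 (R : realType) (d : nat) (hd : (2 <= d)%N) :
  exists2 c : R, 0 < c &
  forall (eps : R) (n : 'I_d -> nat),
    0 < eps -> eps < 1 -> (forall s : 'I_d, (0 < n s)%N) ->
  forall A : tensor R n,
  exists (B : tensor R n) (rho : 'I_d.+1 -> nat),
    [/\ is_tt_rank B rho,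
        forall k : 'I_d.+1, (0 < k < d)%N ->
          (rho k)%:Z <=
          Num.ceil (c / eps ^+ 2 * ln (2 * expR 1 * (\prod_(s < d) n s)%:R))
      & max_norm (A - B) <= eps * gamma_TT A].
Proof.
have d0 : (0 < d)%N by exact: ltnW.
(* Twice the factor [d 2 ^ (d^2)] of the compression error, to make up for the factor 2 lost in
   [gamma_TT_near]. With [delta = eps / D] the error is at most [(eps / 2) (2 gamma)]. *)
have [D DE] : exists D : R, D = 2 * (d%:R * 2 ^+ (d * d)) by eexists.
have D1 : 1 <= D.
  have h1 : 1 <= d%:R :> R by rewrite ler1n.
  have h2 : 1 <= 2 ^+ (d * d) :> R by rewrite exprn_ege1 // ler1n.
  rewrite DE; nra.
have D0 : 0 < D := lt_le_trans ltr01 D1.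
(* With this constant, [delta^2 x = 40 ln (2 e N)] for [delta = eps / D], as the compression
   requires. *)
exists (40 * D ^+ 2); first by rewrite mulr_gt0 // exprn_gt0.
move=> eps n e0 e1 n0 A.
set N := (\prod_(s < d) n s)%N; set x := (_ * ln _).
have N0 : (0 < N)%N by rewrite /N prodn_gt0.
have N1 : 1 <= N%:R :> R by rewrite ler1n.
have expR1_ge2 : 2 <= expR 1 :> R by have := expR_ge1Dx (1 : R); lra.
have lnle : ln ((4 * N)%:R : R) <= ln (2 * expR 1 * N%:R).
  rewrite ler_ln ?posrE ?natrM ?mulr_gt0 ?expR_gt0 ?ltr0n //; nra.
have ln_gt0 : 0 < ln (2 * expR 1 * N%:R : R).
  apply: lt_le_trans lnle; rewrite ln_gt0 // ltr1n; lia.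
have x0 : 0 < x by rewrite /x !mulr_gt0 ?invr_gt0 ?exprn_gt0.
pose r := `|Num.ceil x|%N.
have rE : r%:Z = Num.ceil x by rewrite gtz0_abs // ceil_gt0.
have r0 : (0 < r)%N by rewrite -ltz_nat rE ceil_gt0.
have xr : x <= r%:R by rewrite -[r%:R]/(r%:Z%:~R) rE ceil_ge.
(* It suffices to bound the bond dimensions of one factorization, since the TT rank lies below them
   componentwise. *)
suff [G Grk GA] : exists2 G : tt_cores R n,
    forall k : 'I_d.+1, (0 < k < d)%N -> (tt_rk G k <= r)%N &
    forall I, `|A I - TT G I| <= eps * gamma_TT A.
  have [rho rhoP] := tt_rank_exists G; exists (TT G), rho; split=> //.
    move=> k kd; rewrite -rE lez_nat; apply: leq_trans (Grk k kd).
    by case: rhoP => _; apply.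
  apply: bigmax_le; first by rewrite mulr_ge0 ?(ltW e0) ?gamma_TT_ge0.
  by move=> I _; rewrite 2!ffunE.
(* The zero tensor would leave no slack in the infimum and is represented by zero cores of rank
   1. *)
have [->|A0] := eqVneq A 0.
  have [G GA G1] := zero_TT R n d0; exists G => [k _|I]; first by rewrite G1.
  by rewrite GA subrr normr0 mulr_ge0 ?(ltW e0) ?gamma_TT_ge0.
have [G <- Gg] := gamma_TT_near hd n0 A0.
have De : 0 < eps / D by rewrite divr_gt0.
have [||G' G'rk G'err] := @tt_compression R d n G (eps / D) r d0 De _ r0.
- by rewrite ler_pdivrMr ?mul1r; lra.
- apply: le_trans (_ : _ <= (eps / D) ^+ 2 * x) _; last first.
    by rewrite ler_wpM2l // sqr_ge0.
  have -> : (eps / D) ^+ 2 * x = 40 * ln (2 * expR 1 * N%:R).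
    by rewrite /x; field; rewrite !gt_eqF //; lra.
  by rewrite ler_wpM2l.
exists G' => [k kd|I]; first by rewrite G'rk.
apply: le_trans (G'err I) _.
have -> : d%:R * (eps / D * 2 ^+ (d * d)) = eps / 2.
  rewrite DE; field.
  by rewrite expf_neq0 ?pnatr_eq0 -?lt0n ?d0.
have -> : eps * gamma_TT (TT G) = eps / 2 * (2 * gamma_TT (TT G)) by field.
by rewrite ler_wpM2l // divr_ge0 // ltW.
Qed.
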